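(* Let $d\ge4$ be even and $1<k<d$ an integer. For $(p,q)\in\mathbb{R}^2$ let $$\mathcal{L}_{p,q}:M_d(\mathbb{C})\to M_d(\mathbb{C}),\qquad Z\mapsto(1-p-q)\frac{\operatorname{Tr}(Z)}{d}I_d+pZ+q\,\Omega_dZ^\top\Omega_d^*,$$ and for real $u\ge0$ define the quadratic polynomial $$f_u^{(d,k)}(x,y)=\big(1-x-(1+d)y\big)\big(1-(1-kd)x-y\big)+d^2u\,xy.$$ Then $\mathcal{L}_{p,q}$ is $k$-positive if and only if $(p,q)$ satisfies the following inequalities: (1) if $1<k\le\frac d2$ and $k$ is even: $$p+(1+d)q\le1,\quad(1-kd)p+(1+d)q\le1,\quad(1-kd)p+q\le1,\quad p+(1-d)q\le1;$$ (2) if $1<k\le\frac d2$ and $k$ is odd: $$p+(1+d)q\le1,\quad f_{k-1}^{(d,k)}(p,q)\ge0,\quad(1-kd)p+q\le1,\quad p+(1-d)q\le1;$$ (3) if $\frac d2<k<d$ and $k$ is even: $$p+(1+d)q\le1,\quad(1-kd)p+(1+d)q\le1,\quad f_{2k-d}^{(d,k)}(p,q)\ge0,\quad p+(1-d)q\le1;$$ (4) if $\frac d2<k<d$ and $k$ is odd: $$p+(1+d)q\le1,\quad f_{k-1}^{(d,k)}(p,q)\ge0,\quad f_{2k-d}^{(d,k)}(p,q)\ge0,\quad p+(1-d)q\le1.$$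
   Context: $\Omega_d=\begin{pmatrix}0&I_{d/2}\\-I_{d/2}&0\end{pmatrix}$. A linear map $\mathcal{L}$ on $M_d(\mathbb{C})$ is $k$-positive if $\mathrm{id}_k\otimes\mathcal{L}$ on $M_k(\mathbb{C})\otimes M_d(\mathbb{C})$ maps positive semidefinite matrices to positive semidefinite matrices. *)

(* Defs.v *)
From HB Require Import structures.
From mathcomp Require Import all_boot all_order all_algebra.
From mathcomp Require Import sesquilinear spectral reals complex mxtens.

Set Implicit Arguments.
Unset Strict Implicit.
Unset Printing Implicit Defensive.

Import Order.TTheory GRing.Theory Num.Theory.

Local Open Scope ring_scope.
Local Open Scope complex_scope.
Local Open Scope sesquilinear_scope.

(* The complex numbers are [R[i]] for [R : realType]; on [R[i]] the order
   [0 <= z] means that z is real and nonnegative. *)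

Definition psdmx (R : realType) (n : nat) (A : 'M[R[i]]_n) : Prop :=
  A \is hermsymmx /\ forall v : 'cV[R[i]]_n, 0 <= (v^t* *m A *m v) ord0 ord0.

(* X in M_k (x) M_d is indexed by pairs through [mxtens_index], as for the
   Kronecker product [*t]. *)
Definition mxtens_block (R : realType) (k d : nat) (X : 'M[R[i]]_(k * d))
    (i j : 'I_k) : 'M[R[i]]_d :=
  \matrix_(a, b) X (mxtens_index (i, a)) (mxtens_index (j, b)).

Definition id_tens (R : realType) (k d : nat)
    (L : {linear 'M[R[i]]_d -> 'M[R[i]]_d}) (X : 'M[R[i]]_(k * d)) :
    'M[R[i]]_(k * d) :=
  \sum_(i < k) \sum_(j < k) delta_mx i j *t L (mxtens_block X i j).

Lemma id_tensE (R : realType) (k d : nat)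
    (L : {linear 'M[R[i]]_d -> 'M[R[i]]_d}) (A : 'M[R[i]]_k)
    (Z : 'M[R[i]]_d) : id_tens L (A *t Z) = A *t L Z.
Proof.
apply/matrixP => r s; case: (mxtens_indexP r) (mxtens_indexP s) => i a [j b].
rewrite /id_tens tensmxE summxE (bigD1 i) //= summxE (bigD1 j) //= tensmxE.
rewrite mxE !eqxx mul1r !big1 ?addr0; first last.
- by move=> j' nj; rewrite tensmxE mxE [j == _]eq_sym (negPf nj) andbF mul0r.
- move=> i' ni; rewrite summxE big1 // => j' _.
  by rewrite tensmxE mxE [i == _]eq_sym (negPf ni) mul0r.
have -> : mxtens_block (A *t Z) i j = A i j *: Z.
  by apply/matrixP => a' b'; rewrite mxE tensmxE mxE.
by rewrite linearZ mxE.
Qed.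

Definition k_positive (R : realType) (k d : nat)
    (L : {linear 'M[R[i]]_d -> 'M[R[i]]_d}) : Prop :=
  forall X : 'M[R[i]]_(k * d), psdmx X -> psdmx (id_tens L X).

(* Entrywise, so that no cast between d and d/2 + d/2 is needed; for even d
   this is the block matrix of [OmegaE]. *)
Definition Omega (R : realType) (d : nat) : 'M[R[i]]_d :=
  \matrix_(i, j) ((j == i + d./2 :> nat)%N%:R - (i == j + d./2 :> nat)%N%:R).

Lemma OmegaE (R : realType) (m : nat) :
  Omega R (m + m) = block_mx 0 1%:M (- 1%:M) 0.
Proof.
apply/matrixP => i j; rewrite mxE; have -> : (m + m)./2 = m by rewrite addnn doubleK.
have neq (a b : 'I_m) : (a == m + b + m :> nat)%N = false.
  by apply/ltn_eqF; rewrite -addnA ltn_addr.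
have neq' (a b : 'I_m) : (a == b + m :> nat)%N = false.
  by apply/ltn_eqF; rewrite ltn_addl.
have neq2 (a b : 'I_m) : (m + a == m + b + m :> nat)%N = false.
  by rewrite -addnA eqn_add2l neq'.
case: (split_ordP i) => a ->; case: (split_ordP j) => b -> /=.
- by rewrite block_mxEul /= !neq' subr0 mxE.
- by rewrite block_mxEur /= neq subr0 mxE addnC eqn_add2r eq_sym.
- by rewrite block_mxEdl /= neq sub0r !mxE addnC eqn_add2r.
- by rewrite block_mxEdr /= !neq2 subr0 mxE.
Qed.

Definition calL (R : realType) (d : nat) (p q : R) (Z : 'M[R[i]]_d) :
    'M[R[i]]_d :=
  ((1 - p - q)%:C * (\tr Z / d%:R))%:M + p%:C *: Z
  + q%:C *: (Omega R d *m Z^T *m (Omega R d)^t*).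

Fact calL_is_linear (R : realType) (d : nat) (p q : R) :
  linear (@calL R d p q).
Proof.
move=> a A B; rewrite /calL mxtraceD mxtraceZ [_^T]raddfD /= [(a *: A)^T]linearZ /=.
rewrite mulmxDr mulmxDl -scalemxAr -scalemxAl.
have -> : (1 - p - q)%:C * ((a * \tr A + \tr B) / d%:R) =
    a * ((1 - p - q)%:C * (\tr A / d%:R)) + (1 - p - q)%:C * (\tr B / d%:R).
  by rewrite mulrDl mulrDr -mulrA mulrCA.
rewrite raddfD /= -scale_scalar_mx !scalerDr !scalerA ![_ * a]mulrC.
by rewrite [X in X + _ = _]addrACA [LHS]addrACA.
Qed.

HB.instance Definition _ (R : realType) (d : nat) (p q : R) :=
  GRing.isLinear.Build R[i] 'M[R[i]]_d 'M[R[i]]_d *:%R (@calL R d p q)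
    (@calL_is_linear R d p q).

Definition fpoly (R : realType) (d k : nat) (u x y : R) : R :=
  (1 - x - (1 + d%:R) * y) * (1 - (1 - k%:R * d%:R) * x - y)
  + d%:R ^+ 2 * u * x * y.

(* Main.v *)
(* Write a vector of C^k (x) C^d as a [k x d] matrix. Then
   [d * w^* (id_k (x) L)(v v^* ) w] is a quadratic form in the matrices [M] of
   [v] and [N] of [w], and replacing [N] by an orthonormal basis of its row
   space one may assume [N N^* = 1]. With [U = conj(N) Omega], again with
   orthonormal rows, decompose orthogonally [M = S U + A U + M'], [S] symmetric
   and [A] antisymmetric, and [N = G U + N'], where [G = N U^*] is antisymmetric
   and [m = |G|^2], [k - m = |N'|^2]. The form becomes
     [alpha |S|^2 + beta |A|^2 + gamma |M'|^2 + d p |<A, G> + <M', N'>|^2]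
   with [alpha = 1 - p + (d-1) q], [beta = 1 - p - (1+d) q] and
   [gamma = (alpha + beta) / 2]. By Cauchy-Schwarz it is nonnegative for all [M]
   iff [alpha, beta >= 0] and [f_m(p, q) >= 0]. As [f_u] is affine in [u], only
   the extreme values of [m] over all [N] matter. These are [max(0, 2k - d)],
   since [|N'|^2 <= d - k], and [k] or [k - 1], since an antisymmetric
   contraction of odd size has a kernel; both are attained by coordinate
   vectors. *)
Require Import Defs.
From mathcomp Require Import all_boot all_order all_algebra.
From mathcomp Require Import sesquilinear spectral reals complex mxtens.
From mathcomp Require Import ring lra zify.

Set Implicit Arguments.
Unset Strict Implicit.
Unset Printing Implicit Defensive.

Import Order.TTheory GRing.Theory Num.Theory.
Local Open Scope ring_scope.

(** * Hilbert-Schmidt inner product *)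

Section HilbertSchmidt.
Local Open Scope sesquilinear_scope.
Variable C : numClosedFieldType.

Definition hs m n (A B : 'M[C]_(m, n)) : C :=
  \tr (A *m B^t*).

Lemma trmxC_mul m n p (A : 'M[C]_(m, n))
    (B : 'M[C]_(n, p)) : (A *m B)^t* = B^t* *m A^t*.
Proof. by rewrite trmx_mul map_mxM. Qed.

Lemma trmxC_mxtrace n (A : 'M[C]_n) :
  \tr (A^t*) = (\tr A)^*.
Proof. by rewrite rmorph_sum; apply: eq_bigr => i _; rewrite !mxE. Qed.

Lemma hsE m n (A B : 'M[C]_(m, n)) :
  hs A B = \sum_i \sum_j A i j * (B i j)^*.
Proof.
apply: eq_bigr => i _; rewrite mxE; apply: eq_bigr => j _.
by rewrite !mxE.
Qed.

Lemma hs_ge0 m n (A : 'M[C]_(m, n)) : 0 <= hs A A.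
Proof. by rewrite hsE; do 2!apply: sumr_ge0 => ? _; apply: mul_conjC_ge0. Qed.

Lemma hs_conj m n (A B : 'M[C]_(m, n)) : (hs A B)^* = hs B A.
Proof. by rewrite -trmxC_mxtrace trmxC_mul trmxCK. Qed.

Lemma hsDl m n (A A' B : 'M[C]_(m, n)) : hs (A + A') B = hs A B + hs A' B.
Proof. by rewrite /hs mulmxDl mxtraceD. Qed.

Lemma hsZl m n a (A B : 'M[C]_(m, n)) : hs (a *: A) B = a * hs A B.
Proof. by rewrite /hs -scalemxAl mxtraceZ. Qed.

Lemma hsDr m n (A B B' : 'M[C]_(m, n)) : hs A (B + B') = hs A B + hs A B'.
Proof. by rewrite -hs_conj hsDl rmorphD /= !hs_conj. Qed.

Lemma hsZr m n a (A B : 'M[C]_(m, n)) : hs A (a *: B) = a^* * hs A B.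
Proof. by rewrite -hs_conj hsZl rmorphM /= hs_conj. Qed.

Lemma hsNl m n (A B : 'M[C]_(m, n)) : hs (- A) B = - hs A B.
Proof. by rewrite -scaleN1r hsZl mulN1r. Qed.

Lemma hsNr m n (A B : 'M[C]_(m, n)) : hs A (- B) = - hs A B.
Proof. by rewrite -hs_conj hsNl rmorphN /= hs_conj. Qed.

Lemma hs_tr m n (A B : 'M[C]_(m, n)) : hs A^T B^T = hs A B.
Proof.
rewrite !hsE exchange_big; apply: eq_bigr => i _; apply: eq_bigr => j _.
by rewrite !mxE.
Qed.

Lemma hs_adj m n (A : 'M[C]_(m, n)) : hs (A^t*) (A^t*) = hs A A.
Proof. by rewrite /hs trmxCK mxtrace_mulC. Qed.

Lemma hs_mull m n p (P : 'M[C]_(p, m)) (A : 'M_(m, n)) B :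
  hs (P *m A) B = hs A (P^t* *m B).
Proof. by rewrite /hs trmxC_mul trmxCK -mulmxA mxtrace_mulC mulmxA. Qed.

Lemma hs_mulr m n p (Q : 'M[C]_(n, p)) (A : 'M_(m, n)) B :
  hs (A *m Q) B = hs A (B *m Q^t*).
Proof. by rewrite /hs trmxC_mul trmxCK mulmxA. Qed.

Lemma hs0r m n (A : 'M[C]_(m, n)) : hs A 0 = 0.
Proof. by rewrite -(scale0r 0) hsZr rmorph0 mul0r. Qed.

Lemma hs_eq0 m n (A : 'M[C]_(m, n)) : hs A A = 0 -> A = 0.
Proof.
rewrite hsE => /eqP; rewrite psumr_eq0 => [/allP h|i _]; last first.
  by apply: sumr_ge0 => j _; apply: mul_conjC_ge0.
apply/matrixP => i j; move: (h i (mem_index_enum _)) => /=.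
rewrite psumr_eq0 => [/allP/(_ j (mem_index_enum _))|? _]; last exact: mul_conjC_ge0.
by rewrite /= mul_conjC_eq0 mxE => /eqP.
Qed.

Lemma hs_CauchySchwarz m n (A B : 'M[C]_(m, n)) :
  `|hs A B| ^+ 2 <= hs A A * hs B B.
Proof.
have [/hs_eq0 ->|B_neq0] := eqVneq (hs B B) 0.
  by rewrite !hs0r mulr0 normr0 expr0n.
have B_gt0 : 0 < hs B B by rewrite lt_def B_neq0 hs_ge0.
rewrite -subr_ge0 -(pmulr_rge0 _ B_gt0).
have := hs_ge0 (hs B B *: A + (- hs A B) *: B).
rewrite !(hsDl, hsDr, hsZl, hsZr) normCK !rmorphN /= !hs_conj.
by congr (0 <= _); ring.
Qed.

Lemma unitarymx_hs m n (U : 'M[C]_(m, n)) : U \is unitarymx -> hs U U = m%:R.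
Proof. by move/unitarymxP; rewrite /hs => ->; rewrite mxtrace1. Qed.

(** Pythagoras: the rows of [A'] and [B'] are orthogonal to the orthonormal rows of [U], so both
    cross terms vanish. *)
Lemma hs_unitary_split m n p (U : 'M[C]_(n, p)) (A B : 'M_(m, n)) A' B' :
    U \is unitarymx -> A' *m U^t* = 0 -> B' *m U^t* = 0 ->
  hs (A *m U + A') (B *m U + B') = hs A B + hs A' B'.
Proof.
move=> Uu A'0 B'0; rewrite !(hsDl, hsDr) !hs_mulr B'0 hs0r addr0.
rewrite (mulmxtVK _ Uu) -[hs A' _]hs_conj hs_mulr A'0 hs0r rmorph0.
by rewrite add0r.
Qed.

(** Bessel's inequality, from expanding the squared norm of [X - U^t* *m (U *m X)]. *)
Lemma hs_unitary_mull m n p (U : 'M[C]_(m, n)) (X : 'M_(n, p)) :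
  U \is unitarymx -> hs (U *m X) (U *m X) <= hs X X.
Proof.
move=> Uu; rewrite -subr_ge0.
have := hs_ge0 (X - U^t* *m (U *m X)).
have UUX : U *m (U^t* *m (U *m X)) = U *m X.
  by rewrite mulmxA (unitarymxP Uu) mul1mx.
rewrite !(hsDl, hsDr, hsNl, hsNr) !(hs_mull (U^t*)) trmxCK UUX -hs_mull.
by congr (0 <= _); ring.
Qed.

Lemma hs_unitary_mulr m n p (U : 'M[C]_(m, n)) (X : 'M_(p, n)) :
  U \is unitarymx -> hs (X *m U^t*) (X *m U^t*) <= hs X X.
Proof.
move=> Uu; rewrite -[leLHS]hs_adj -[leRHS]hs_adj trmxC_mul trmxCK.
exact: hs_unitary_mull.
Qed.

(** [P] projects onto the orthogonal complement of the row space of [U], and the squared norm of an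
    orthogonal projection is its rank. *)
Lemma hs_coproj m n (U : 'M[C]_(m, n)) : U \is unitarymx ->
  let P := 1%:M - U^t* *m U in hs P P = n%:R - m%:R.
Proof.
move=> Uu P; have UUU : U *m (U^t* *m U) = U by rewrite mulmxA (unitarymxP Uu) mul1mx.
have U1 : hs 1%:M (U^t* *m U) = m%:R.
  by rewrite -hs_mull mulmx1 unitarymx_hs.
have hs1 : hs 1%:M (1%:M : 'M[C]_n) = n%:R.
  by rewrite /hs trmx1 map_mx1 mulmx1 mxtrace1.
rewrite /P !(hsDl, hsDr, hsNl, hsNr) !(hs_mull (U^t*)) trmxCK UUU.
by rewrite mulmx1 U1 hs1 unitarymx_hs //; ring.
Qed.

Lemma skew_odd_det0 n (G : 'M[C]_n) : odd n -> G^T = - G -> \det G = 0.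
Proof.
move=> n_odd Gskew; have := det_tr G.
rewrite Gskew -scaleN1r detZ -signr_odd n_odd expr1 mulN1r => /eqP.
by rewrite eq_sym -addr_eq0 -mulr2n mulrn_eq0 /= => /eqP.
Qed.

(* An antisymmetric matrix of odd size kills a unit vector, so a contraction
   of this kind loses at least one unit of squared norm. *)
Lemma hs_skew_odd k d (N U : 'M[C]_(k, d)) : N \is unitarymx ->
    U \is unitarymx -> odd k -> (N *m U^t*)^T = - (N *m U^t*) ->
  hs (N *m U^t*) (N *m U^t*) <= k%:R - 1.
Proof.
move=> Nu Uu k_odd /(skew_odd_det0 k_odd) /eqP /det0P [v v_neq0 vG].
pose y := (sqrtC (hs v v))^-1 *: v.
have v_gt0 : 0 < hs v v.
  by rewrite lt_def hs_ge0 andbT; apply: contraNneq v_neq0 => /hs_eq0 ->.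
have yu : y \is unitarymx.
  apply/unitarymxP/matrixP => i j; rewrite !ord1 [RHS]mxE eqxx.
  have -> : (y *m y^t*) 0 0 = hs y y by rewrite /hs /mxtrace big_ord1.
  rewrite hsZl hsZr geC0_conj ?invr_ge0 ?sqrtC_ge0 ?hs_ge0 // mulrA -expr2.
  by rewrite exprVn sqrtCK mulVf // gt_eqF.
have yG : y *m (N *m U^t*) = 0 by rewrite -scalemxAl vG scaler0.
(* As [y] kills [G], the projection off [y] can be inserted in front. Dropping the contraction
   [U^t*] and then the orthonormal [N] leaves that projection alone, of squared norm [k - 1]. *)
have -> : N *m U^t* = (1%:M - y^t* *m y) *m N *m U^t*.
  by rewrite -!mulmxA mulmxBl mul1mx -!mulmxA yG mulmx0 subr0.
apply: le_trans (hs_unitary_mulr _ Uu) _.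
by rewrite hs_mulr (mulmxtVK _ Nu) hs_coproj.
Qed.

End HilbertSchmidt.

(** * The quadratic form for a fixed orthonormal frame *)

Section QuadraticForm.
Local Open Scope sesquilinear_scope.
Variable C : numClosedFieldType.

(* With [N] orthonormal and [U = conj N *m Omega], this is [d] times the value
   of [w^* (id_k (x) L)(v v^* ) w] at the vectors [v], [w] with matrices [M],
   [N]. *)
Definition quad k d (c s e : C) (N U M : 'M[C]_(k, d)) : C :=
  c * hs M M + s * `|hs M N| ^+ 2 + e * hs (M *m U^t*) (M *m U^t*)^T.

Lemma quad_split k d (c s e : C) (N U : 'M[C]_(k, d)) (L : 'M_k) M' :
    U \is unitarymx -> M' *m U^t* = 0 ->
    let G := N *m U^t* in let N' := N - G *m U in
  quad c s e N U (L *m U + M') = c * (hs L L + hs M' M')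
    + s * `|hs L G + hs M' N'| ^+ 2 + e * hs L L^T.
Proof.
move=> Uu M'U G N'; have N'U : N' *m U^t* = 0.
  by rewrite mulmxBl (mulmxtVK _ Uu) subrr.
have -> : N = G *m U + N' by rewrite addrC subrK.
by rewrite /quad !hs_unitary_split // mulmxDl M'U addr0 (mulmxtVK _ Uu).
Qed.

Lemma hs_compl k d (N U : 'M[C]_(k, d)) : N \is unitarymx -> U \is unitarymx ->
    let G := N *m U^t* in let N' := N - G *m U in
  hs N' N' = k%:R - hs G G.
Proof.
move=> Nu Uu G N'; have N'U : N' *m U^t* = 0.
  by rewrite mulmxBl (mulmxtVK _ Uu) subrr.
rewrite -(unitarymx_hs Nu) {1 2}(_ : N = G *m U + N') ?hs_unitary_split //.
  by rewrite addrC addKr.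
by rewrite addrC subrK.
Qed.

Lemma hs_compl_le k d (N U : 'M[C]_(k, d)) : N \is unitarymx ->
    U \is unitarymx ->
  hs (N - N *m U^t* *m U) (N - N *m U^t* *m U) <= d%:R - k%:R.
Proof.
move=> Nu Uu; rewrite -(hs_coproj Uu).
have -> : N - N *m U^t* *m U = N *m (1%:M - U^t* *m U) by rewrite mulmxBr mulmx1 mulmxA.
exact: hs_unitary_mull.
Qed.

(** Transposition acts as 1 on the symmetric part of [M *m U^t*] and as -1 on the antisymmetric
    part, which gives the coefficients [c + e] and [c - e]. The symmetric part is orthogonal to the
    antisymmetric [G], hence absent from the last term. Here [t1] and [t2] are the inner products
    with [G] and [N'], bounded by Cauchy-Schwarz. *)
Lemma quad_sym k d (c s e : C) (N U M : 'M[C]_(k, d)) :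
    N \is unitarymx -> U \is unitarymx ->
    let G := N *m U^t* in G^T = - G ->
  exists S A B t1 t2 : C, [/\ 0 <= S, 0 <= A, 0 <= B &
    [/\ `|t1| ^+ 2 <= A * hs G G, `|t2| ^+ 2 <= B * (k%:R - hs G G) &
    quad c s e N U M =
      (c + e) * S + (c - e) * A + c * B + s * `|t1 + t2| ^+ 2]].
Proof.
move=> Nu Uu G Gskew; pose L := M *m U^t*; pose M' := M - L *m U.
pose S := 2^-1 *: (L + L^T); pose A := 2^-1 *: (L - L^T).
have ST : S^T = S by rewrite linearZ linearD /= trmxK addrC.
have AT : A^T = - A by rewrite linearZ linearB /= trmxK -scalerN opprB.
have LSA : L = S + A.
  rewrite -scalerDr addrACA subrr addr0 -mulr2n -scaler_nat scalerA mulVf ?scale1r //.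
  by rewrite pnatr_eq0.
have skew_orth (X Y : 'M[C]_k) : X^T = X -> Y^T = - Y -> hs X Y = 0.
  move=> XT YT; apply/eqP; suff: hs X Y *+ 2 == 0 by rewrite mulrn_eq0.
  by rewrite mulr2n -{1}hs_tr XT YT hsNr addNr.
have hSA := skew_orth _ _ ST AT; have hSG := skew_orth _ _ ST Gskew.
have hAS : hs A S = 0 by rewrite -hs_conj hSA rmorph0.
exists (hs S S), (hs A A), (hs M' M'), (hs A G), (hs M' (N - G *m U)).
rewrite !hs_ge0; split=> //; split; first exact: hs_CauchySchwarz.
  by rewrite -(hs_compl Nu Uu); apply: hs_CauchySchwarz.
have -> : M = L *m U + M' by rewrite addrC subrK.
rewrite quad_split //; last by rewrite mulmxBl (mulmxtVK _ Uu) subrr.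
rewrite LSA linearD /= ST AT !(hsDl, hsDr, hsNl, hsNr) -/G hSA hAS hSG.
by rewrite !(add0r, addr0, oppr0); ring.
Qed.

(** This matrix is the equality case of the weighted Cauchy-Schwarz inequality: the weights [c] on
    [G] and [c - e] on [N'] are inversely proportional to the coefficients [c - e] and [c] of the
    form. The number [t] is its inner product with [N]. *)
Lemma quad_extremal k d (c s e : C) (N U : 'M[C]_(k, d)) :
    N \is unitarymx -> U \is unitarymx ->
    c \is Num.real -> e \is Num.real ->
    let G := N *m U^t* in G^T = - G ->
    let t := c * hs G G + (c - e) * (k%:R - hs G G) in
  quad c s e N U (c *: G *m U + (c - e) *: (N - G *m U))
    = t * (c * (c - e) + s * t).
Proof.
move=> Nu Uu cR eR G Gskew t; rewrite quad_split //; last first.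
  by rewrite -scalemxAl mulmxBl (mulmxtVK _ Uu) subrr scaler0.
have beR : c - e \is Num.real by rewrite rpredB.
rewrite linearZ /= Gskew !(hsZl, hsZr) hsNr -/G (hs_compl Nu Uu) -/G.
rewrite !(CrealP _) // real_normK //.
  by rewrite /t; ring.
have GR : hs G G \is Num.real by rewrite ger0_real ?hs_ge0.
by rewrite rpredD ?rpredM ?rpredB ?realn.
Qed.

(** A left factor [T] in the matrix of [w] can be moved as [T^t*] onto the matrix of [v]. This is
    what allows orthonormal rows to be assumed, even when the matrix of [w] has dependent rows. *)
Lemma quad_reduce k d (c s e : C) (T : 'M[C]_k) (N M : 'M[C]_(k, d))
    (Om : 'M_d) :
    N \is unitarymx ->
    let U := map_mx Num.conj (T *m N) *m Om in
  c * hs ((T *m N)^t* *m M) ((T *m N)^t* *m M) + s * `|hs M (T *m N)| ^+ 2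
    + e * hs (M *m U^t*) (M *m U^t*)^T
  = quad c s e N (map_mx Num.conj N *m Om) (T^t* *m M).
Proof.
move=> Nu U.
have E1 : hs ((T *m N)^t* *m M) ((T *m N)^t* *m M)
    = hs (T^t* *m M) (T^t* *m M).
  rewrite trmxC_mul -mulmxA hs_mull trmxCK mulmxA (unitarymxP Nu).
  by rewrite mul1mx.
have E2 : hs M (T *m N) = hs (T^t* *m M) N by rewrite hs_mull trmxCK.
pose W := M *m (map_mx Num.conj N *m Om)^t*.
have MU : M *m U^t* = W *m T^T.
  by rewrite /U map_mxM -mulmxA trmxC_mul map_trmx map_mxCK mulmxA.
have hsT (A : 'M[C]_k) : hs A A^T = \tr (A *m map_mx Num.conj A).
  by rewrite /hs trmxK.
have TC : map_mx Num.conj (T^t*) = T^T by apply: map_mxCK.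
(* Both sides are traces of the same four factors up to a cyclic shift. *)
have E3 (V : 'M[C]_k) : hs (V *m T^T) (V *m T^T)^T = hs (T^t* *m V) (T^t* *m V)^T.
  rewrite !hsT !map_mxM TC [X in \tr X = _]mulmxA mxtrace_mulC.
  by rewrite !mulmxA.
by rewrite E1 E2 MU E3 /quad -mulmxA.
Qed.

Lemma hs_delta m n i j (A : 'M[C]_(m, n)) : hs (delta_mx i j) A = (A i j)^*.
Proof.
rewrite hsE (bigD1 i) //= (bigD1 j) //= mxE !eqxx mul1r !big1 ?addr0 //; last first.
  by move=> a /negPf na; rewrite mxE na andbF mul0r.
by move=> a /negPf na; apply: big1 => b _; rewrite mxE na mul0r.
Qed.

Lemma skew_diag0 k (G : 'M[C]_k) i : G^T = - G -> G i i = 0.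
Proof.
move/matrixP/(_ i i); rewrite !mxE => /eqP.
by rewrite -addr_eq0 -mulr2n mulrn_eq0 /= => /eqP.
Qed.

(* The matrices [E_00] and [E_01 - E_10] isolate the two coefficients of the
   quadratic form. *)
Lemma quad_coef_sym k d (c s e : C) (N U : 'M[C]_(k, d)) (i : 'I_k) :
    U \is unitarymx -> (N *m U^t*)^T = - (N *m U^t*) ->
    (forall M, 0 <= quad c s e N U M) ->
  0 <= c + e.
Proof.
move=> Uu Gskew /(_ (delta_mx i i *m U + 0)).
rewrite quad_split ?mul0mx // hs0r trmx_delta !hs_delta (skew_diag0 _ Gskew).
rewrite !mxE !eqxx conjC0 conjC1.
have -> : hs (0 : 'M[C]_(k, d)) (N - N *m U^t* *m U) = 0.
  by rewrite -hs_conj hs0r conjC0.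
by rewrite !addr0 normr0 expr0n mulr0 !mulr1 addr0.
Qed.

Lemma quad_coef_skew k d (c s e : C) (N U : 'M[C]_(k, d)) (i j : 'I_k) :
    U \is unitarymx -> i != j -> (N *m U^t*) i j = 0 -> (N *m U^t*) j i = 0 ->
    (forall M, 0 <= quad c s e N U M) ->
  0 <= c - e.
Proof.
move=> Uu /negPf ij Gij Gji /(_ ((delta_mx i j - delta_mx j i) *m U + 0)).
rewrite quad_split ?mul0mx // hs0r.
have -> : hs (0 : 'M[C]_(k, d)) (N - N *m U^t* *m U) = 0.
  by rewrite -hs_conj hs0r conjC0.
rewrite linearB /= !trmx_delta !(hsDl, hsDr, hsNl, hsNr) !hs_delta Gij Gji.
rewrite !mxE !eqxx ij eq_sym ij !(conjC0, conjC1).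
rewrite !(addr0, oppr0, add0r, opprK, normr0, expr0n, mulr0).
have -> : c * (1 + 1) + e * (-1 - 1) = (c - e) * 2 by ring.
by rewrite pmulr_lge0 ?ltr0Sn.
Qed.

(* [G] is a contraction, whose defect [k - |G|^2] is at most [d - k] because
   it is carried by the [d - k] dimensions orthogonal to the rows of [U]. *)
Lemma hs_gram_bounds k d (N U : 'M[C]_(k, d)) : ~~ odd d ->
    N \is unitarymx -> U \is unitarymx -> (N *m U^t*)^T = - (N *m U^t*) ->
  (2 * (k - d./2))%N%:R <= hs (N *m U^t*) (N *m U^t*) /\
  hs (N *m U^t*) (N *m U^t*) <= (k./2.*2)%:R.
Proof.
move=> d_even Nu Uu Gskew; split.
  (* Truncated subtraction makes the lower bound the maximum of 0 and [2k - d]. *)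
  have [kh|hk] := leqP k d./2.
    by rewrite (_ : (2 * (k - d./2))%N = 0%N) ?hs_ge0 //; lia.
  have := hs_compl_le Nu Uu; rewrite (hs_compl Nu Uu) -subr_ge0 => h.
  rewrite -subr_ge0; apply: le_trans h _; rewrite le_eqVlt; apply/orP; left.
  have -> : (2 * (k - d./2) = k + k - d)%N by lia.
  by apply/eqP; rewrite natrB ?natrD; [ring | lia].
have [k_odd|k_even] := boolP (odd k).
  have := hs_skew_odd Nu Uu k_odd Gskew.
  rewrite -[1]/(1%:R) -natrB; last by lia.
  by have -> : (k - 1 = k./2.*2)%N by lia.
rewrite even_halfK // -(unitarymx_hs Nu).
exact: hs_unitary_mulr.
Qed.

Definition coordmx k d (f : 'I_k -> 'I_d) : 'M[C]_(k, d) :=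
  \matrix_(i, j) (j == f i)%:R.

Lemma coordmx_mul k d n (f : 'I_k -> 'I_d) (X : 'M[C]_(d, n)) i j :
  (coordmx f *m X) i j = X (f i) j.
Proof.
rewrite mxE (bigD1 (f i)) //= mxE eqxx mul1r big1 ?addr0 // => a /negPf na.
by rewrite mxE na mul0r.
Qed.

Lemma coordmx_conj k d (f : 'I_k -> 'I_d) :
  map_mx Num.conj (coordmx f) = coordmx f.
Proof. by apply/matrixP => i j; rewrite !mxE conjC_nat. Qed.

Lemma coordmx_unitary k d (f : 'I_k -> 'I_d) :
  injective f -> coordmx f \is unitarymx.
Proof.
move=> f_inj; apply/unitarymxP; rewrite -map_trmx coordmx_conj.
by apply/matrixP => i j; rewrite coordmx_mul !mxE (inj_eq f_inj).
Qed.

Lemma coordmx_form k d (f : 'I_k -> 'I_d) (X : 'M[C]_d) i j :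
  (coordmx f *m X *m (coordmx f)^T) i j = X (f i) (f j).
Proof.
rewrite -mulmxA coordmx_mul.
have -> : X *m (coordmx f)^T = (coordmx f *m X^T)^T by rewrite trmx_mul trmxK.
by rewrite [LHS]mxE coordmx_mul mxE.
Qed.

End QuadraticForm.

(** * Reduction of k-positivity to the quadratic form *)

Section Reduction.
Local Open Scope sesquilinear_scope.
Variable R : realType.
Local Notation C := R[i].
Local Notation toC := (real_complex R).

Lemma row_form m n (A : 'M[C]_(m, n)) B (D : 'M[C]_(m, n)) i j :
  (row i A *m B *m (row j D)^T) 0 0 = (A *m B *m D^T) i j.
Proof. by rewrite -row_mul !mxE; apply: eq_bigr => a _; rewrite !mxE. Qed.

Lemma sum_mul_mx n (X Y : 'M[C]_n) :
  \sum_i \sum_j X i j * Y i j = \tr (X *m Y^T).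
Proof.
by apply: eq_bigr => i _; rewrite mxE; apply: eq_bigr => j _; rewrite mxE.
Qed.

Lemma big_mxtens k d (F : 'I_(k * d) -> C) :
  \sum_r F r = \sum_i \sum_a F (mxtens_index (i, a)).
Proof.
rewrite pair_bigA /= (reindex (@mxtens_index k d)) /=.
  by apply: eq_bigr => -[].
by exists (@mxtens_unindex k d) => r _; rewrite ?mxtens_indexK ?mxtens_unindexK.
Qed.

Definition vecmx k d (N : 'M[C]_(k, d)) : 'cV[C]_(k * d) :=
  \col_r N (mxtens_unindex r).1 (mxtens_unindex r).2.

Lemma vecmxE k d (N : 'M[C]_(k, d)) i a s :
  vecmx N (mxtens_index (i, a)) s = N i a.
Proof. by rewrite mxE mxtens_indexK. Qed.

Lemma vecmx_surj k d (v : 'cV[C]_(k * d)) : exists N, v = vecmx N.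
Proof.
exists (\matrix_(i, a) v (mxtens_index (i, a)) 0); apply/matrixP => r s.
by case: (mxtens_indexP r) => i a; rewrite vecmxE mxE ord1.
Qed.

Lemma mxtens_block_id_tens k d (L : {linear 'M[C]_d -> 'M[C]_d})
    (X : 'M[C]_(k * d)) i j :
  mxtens_block (id_tens L X) i j = L (mxtens_block X i j).
Proof.
apply/matrixP => a b; rewrite mxE summxE (bigD1 i) //= summxE (bigD1 j) //=.
rewrite tensmxE mxE !eqxx mul1r !big1 ?addr0 //; first last.
- by move=> j' nj; rewrite tensmxE mxE [j == _]eq_sym (negPf nj) andbF mul0r.
- move=> i' ni; rewrite summxE big1 // => j' _.
  by rewrite tensmxE mxE [i == _]eq_sym (negPf ni) mul0r.
Qed.

Lemma form_vecmx k d (A : 'M[C]_(k * d)) (N : 'M[C]_(k, d)) :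
  ((vecmx N)^t* *m A *m vecmx N) 0 0 =
  \sum_i \sum_j
    (row i (map_mx Num.conj N) *m mxtens_block A i j *m (row j N)^T) 0 0.
Proof.
rewrite mxE big_mxtens exchange_big.
under eq_bigr => b _ do under eq_bigr => j _ do rewrite mxE big_mxtens mulr_suml.
under [RHS]eq_bigr => i _ do under eq_bigr => j _ do rewrite mxE.
under [RHS]eq_bigr => i _ do under eq_bigr => j _ do
  under eq_bigr => b _ do rewrite mxE mulr_suml.
rewrite exchange_big [RHS]exchange_big; apply: eq_bigr => j _.
rewrite [RHS]exchange_big; apply: eq_bigr => b _.
apply: eq_bigr => i _; rewrite mulr_suml; apply: eq_bigr => a _.
by rewrite !mxE !mxtens_indexK.
Qed.

Lemma mxtens_block_vecmx k d (M : 'M[C]_(k, d)) i j :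
  mxtens_block (vecmx M *m (vecmx M)^t*) i j =
    (row i M)^T *m row j (map_mx Num.conj M).
Proof.
apply/matrixP => a b; rewrite mxE !mxE !big_ord1.
by rewrite vecmxE !mxE mxtens_indexK.
Qed.

Lemma id_tens_sum k d (L : {linear 'M[C]_d -> 'M[C]_d}) n (a : 'I_n -> C)
    (X : 'I_n -> 'M[C]_(k * d)) :
  id_tens L (\sum_r a r *: X r) = \sum_r a r *: id_tens L (X r).
Proof.
apply/matrixP => u v; case: (mxtens_indexP u) (mxtens_indexP v) => i b [j e].
have E Y : id_tens L Y (mxtens_index (i, b)) (mxtens_index (j, e))
    = L (mxtens_block Y i j) b e by rewrite -mxtens_block_id_tens mxE.
rewrite E summxE; under [RHS]eq_bigr => r _ do rewrite mxE E.
have -> : mxtens_block (\sum_r a r *: X r) i j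
    = \sum_r a r *: mxtens_block (X r) i j.
  apply/matrixP => b' e'; rewrite mxE !summxE.
  by apply: eq_bigr => r _; rewrite !mxE.
rewrite linear_sum summxE; apply: eq_bigr => r _.
by rewrite linearZ mxE.
Qed.

(** Spectral theorem, with eigenvalues nonnegative as values of the form at the eigenvectors.
    Positivity of [id_tens L] then needs testing on rank-one inputs only. *)
Lemma psdmx_decomp n (X : 'M[C]_n) : psdmx X ->
  exists (a : 'I_n -> C) (v : 'I_n -> 'cV[C]_n),
    (forall r, 0 <= a r) /\ X = \sum_r a r *: (v r *m (v r)^t*).
Proof.
move=> [Xh Xpos]; have /orthomx_spectralP XE := hermitian_normalmx Xh.
set P := spectralmx X in XE; set D := spectral_diag X in XE.
have Pu : P \is unitarymx by apply: spectral_unitarymx.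
exists (D 0), (fun r => (row r (map_mx Num.conj P))^T).
have vC r : ((row r (map_mx Num.conj P))^T)^t* = row r P by rewrite trmxK map_row map_mxCK.
split=> [r|].
  have -> : D 0 r = (P *m X *m (map_mx Num.conj P)^T) r r.
    rewrite XE invmx_unitary // map_trmx !mulmxA (unitarymxP Pu) mul1mx.
    by rewrite -mulmxA (unitarymxP Pu) mulmx1 mxE eqxx.
  by rewrite -row_form -vC; apply: Xpos.
rewrite [LHS]XE invmx_unitary // mul_mx_diag.
apply/matrixP => a b; rewrite mxE summxE; apply: eq_bigr => r _.
by rewrite vC !mxE big_ord1 !mxE mulrAC mulrC.
Qed.

Lemma psdmx_vecmx n (v : 'cV[C]_n) : psdmx (v *m v^t*).
Proof.
split.
  by apply/sesquiP; rewrite expr0 scale1r trmxC_mul trmxCK.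
move=> w; rewrite mulmxA -mulmxA mxE big_ord1.
have -> : (w^t* *m v) 0 0 = ((v^t* *m w) 0 0)^*.
  by rewrite -[in LHS](trmxCK v) -trmxC_mul !mxE.
by rewrite mulrC mul_conjC_ge0.
Qed.

Lemma Omega_conj d : map_mx Num.conj (Omega R d) = Omega R d.
Proof. by apply/matrixP => i j; rewrite !mxE rmorphB /= !conjC_nat. Qed.

Lemma Omega_trmx d : (Omega R d)^T = - Omega R d.
Proof. by apply/matrixP => i j; rewrite !mxE opprB. Qed.

Lemma Omega_unitary d : ~~ odd d -> Omega R d \is unitarymx.
Proof.
move=> d_even; have [h ->] : exists h, d = (h + h)%N.
  by exists d./2; rewrite addnn even_halfK.
apply/unitarymxP; rewrite -map_trmx Omega_conj Omega_trmx OmegaE mulmxN.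
rewrite mulmx_block !(mul0mx, mulmx0, mul1mx, mulmx1, mulNmx, addr0, add0r).
by rewrite opp_block_mx !(oppr0, opprK) -scalar_mx_block.
Qed.

(** On the block built from rows [i] and [j] of [M], the trace term yields a product of Gram
    entries, and the identity term splits into a factor in [i] times a factor in [j]. The transpose
    swaps the two rows and pairs each with the other index of [N], giving [L] against [L^T], with
    [Omega] absorbed into [U]. *)
Lemma id_tens_calL_form k d p q (M N : 'M[C]_(k, d)) : (0 < d)%N ->
    let U := map_mx Num.conj N *m Omega R d in
  ((vecmx N)^t* *m id_tens (@calL R d p q) (vecmx M *m (vecmx M)^t*)
     *m vecmx N) 0 0 =
  d%:R^-1 * (toC (1 - p - q) * hs (N^t* *m M) (N^t* *m M)
    + toC (d%:R * p) * `|hs M N| ^+ 2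
    + toC (d%:R * q) * hs (M *m U^t*) (M *m U^t*)^T).
Proof.
move=> d_gt0 U; have d_neq0 : d%:R != 0 :> C by rewrite pnatr_eq0 -lt0n.
pose Nc := map_mx Num.conj N; pose Mc := map_mx Num.conj M.
pose L := M *m U^t*.
have UE : U^t* = (Omega R d)^t* *m N^T.
  by rewrite trmxC_mul map_trmx map_mxCK.
have E1 : \sum_i \sum_j (M *m M^t*) i j * (Nc *m N^T) i j
    = hs (N^t* *m M) (N^t* *m M).
  rewrite sum_mul_mx trmx_mul trmxK map_trmx /hs trmxC_mul trmxCK.
  by rewrite mxtrace_mulC -!mulmxA mxtrace_mulC !mulmxA.
have E2 : \sum_i \sum_j (Nc *m M^T) i i * (Mc *m N^T) j j = `|hs M N| ^+ 2.
  have F (A B : 'M[C]_(k, d)) : \tr (map_mx Num.conj A *m B^T) = hs B A.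
    by rewrite -mxtrace_tr trmx_mul trmxK map_trmx.
  rewrite normCK hs_conj -!F /mxtrace.
  by under eq_bigr do rewrite -mulr_sumr; rewrite -mulr_suml.
have E3 : \sum_i \sum_j (Nc *m Omega R d *m Mc^T) i j * L i j = hs L L^T.
  rewrite hsE; apply: eq_bigr => i _; apply: eq_bigr => j _.
  have -> : Nc *m Omega R d *m Mc^T = L^t*.
    by rewrite trmxC_mul trmxCK map_trmx.
  by rewrite !mxE mulrC.
rewrite form_vecmx -E1 -E2 -E3 mulrDr mulrDr !mulr_sumr -!big_split.
apply: eq_bigr => i _; rewrite !mulr_sumr -!big_split; apply: eq_bigr => j _ /=.
rewrite mxtens_block_id_tens mxtens_block_vecmx -[map_mx _ N]/Nc -[map_mx _ M]/Mc.
have calLE Z : calL p q Z = ((toC (1 - p - q)) * (\tr Z / d%:R))%:M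
  + toC p *: Z + toC q *: (Omega R d *m Z^T *m (Omega R d)^t*) by [].
rewrite /= calLE.
have row_dot (A B : 'M[C]_(k, d)) i' j' :
    (row i' A *m (row j' B)^T) 0 0 = (A *m B^T) i' j'.
  by rewrite -[A in RHS]mulmx1 -row_form mulmx1.
have dot11 (A : 'cV[C]_1) (B : 'rV[C]_1) : (A *m B) 0 0 = A 0 0 * B 0 0.
  by rewrite mxE big_ord1.
have add00 (A B : 'M[C]_1) : (A + B) 0 0 = A 0 0 + B 0 0 by rewrite mxE.
have scale00 a (A : 'M[C]_1) : (a *: A) 0 0 = a * A 0 0 by rewrite mxE.
have trE : \tr ((row i M)^T *m row j Mc) = (M *m M^t*) i j.
  by rewrite mxtrace_mulC -mxtrace_tr trmx_mul trmxK -map_trmx -row_dot /mxtrace big_ord1.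
rewrite trE !(mulmxDr, mulmxDl) !add00; congr (_ + _ + _).
- by rewrite mul_mx_scalar -scalemxAl scale00 row_dot; field.
- rewrite -scalemxAr -scalemxAl scale00 mulmxA -(mulmxA _ (row j Mc)) dot11 !row_dot rmorphM.
  by rewrite rmorph_nat; field.
- rewrite -scalemxAr -scalemxAl scale00 trmx_mul trmxK !mulmxA.
  rewrite -(mulmxA _ (row i M)) -(mulmxA _ _ (row j N)^T) dot11 !row_form.
  by rewrite -(mulmxA M) -UE rmorphM rmorph_nat; field.
Qed.

Lemma toC_conj (x : R) : (toC x)^* = toC x.
Proof. exact: conjc_real. Qed.

Lemma calL_trmxC d p q (Z : 'M[C]_d) : calL p q (Z^t*) = (calL p q Z)^t*.
Proof.
rewrite /calL !(linearD, map_mxD) /= trmxC_mxtrace; congr (_ + _ + _).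
- rewrite tr_scalar_mx map_scalar_mx; congr (_%:M).
  by rewrite !rmorphM /= toC_conj fmorphV rmorph_nat.
- by apply/matrixP => i j; rewrite !mxE rmorphM /= toC_conj.
- rewrite linearZ map_mxZ /= toC_conj !trmxC_mul trmxCK mulmxA.
  by rewrite trmxK -map_trmx trmxK.
Qed.

Lemma id_tens_herm k d (L : {linear 'M[C]_d -> 'M[C]_d}) (X : 'M[C]_(k * d)) :
  (forall Z, L (Z^t*) = (L Z)^t*) -> X \is hermsymmx ->
  id_tens L X \is hermsymmx.
Proof.
move=> LC /sesquiP; rewrite expr0 scale1r => Xh.
have blockC i j : mxtens_block X i j = (mxtens_block X j i)^t*.
  by apply/matrixP => a b; rewrite !mxE [in LHS]Xh !mxE.
apply/sesquiP; rewrite expr0 scale1r; apply/matrixP => u v.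
case: (mxtens_indexP u) (mxtens_indexP v) => i a [j b].
have E i' j' a' b' : id_tens L X (mxtens_index (i', a')) (mxtens_index (j', b'))
    = L (mxtens_block X i' j') a' b' by rewrite -mxtens_block_id_tens mxE.
by rewrite !mxE !E [in LHS]blockC LC !mxE.
Qed.

Lemma k_positive_quad k d p q : ~~ odd d -> (0 < d)%N -> (k <= d)%N ->
  k_positive k (@calL R d p q) <->
  forall N M : 'M[C]_(k, d), N \is unitarymx ->
    0 <= quad (toC (1 - p - q)) (toC (d%:R * p)) (toC (d%:R * q))
           N (map_mx Num.conj N *m Omega R d) M.
Proof.
move=> d_even d_gt0 k_le; have dV : 0 < d%:R^-1 :> C by rewrite invr_gt0 ltr0n.
split=> [kpos N M Nu|quad_pos X Xpsd].
  have := (kpos _ (psdmx_vecmx (vecmx M))).2 (vecmx N).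
  rewrite (id_tens_calL_form _ _ _ _ d_gt0) (pmulr_rge0 _ dV).
  by rewrite -[N]mul1mx (quad_reduce _ _ _ _ _ _ Nu) trmx1 map_mx1 !mul1mx.
split; first exact: (id_tens_herm (@calL_trmxC d p q)) Xpsd.1.
move=> v; have [N ->] := vecmx_surj v.
have [a [w [a_ge0 ->]]] := psdmx_decomp Xpsd.
rewrite id_tens_sum mulmx_sumr mulmx_suml summxE; apply: sumr_ge0 => r _.
rewrite -scalemxAr -scalemxAl mxE mulr_ge0 //.
have [M ->] := vecmx_surj (w r); rewrite (id_tens_calL_form _ _ _ _ d_gt0) (pmulr_rge0 _ dV).
(* Gram-Schmidt: [N] is some [T] times [schmidt N], whose rows are orthonormal because [k <= d],
   whatever the rank of [N]. *)
rewrite -(mulmxKpV (schmidt_sub N)) quad_reduce ?schmidt_unitarymx //.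
by apply: quad_pos; apply: schmidt_unitarymx.
Qed.

End Reduction.

(** * Real inequalities and counting *)

(** Cauchy-Schwarz with weights [b] and [c]: [(r1 + r2)^2] is at most [(m/b + n/c) (b A + c B)],
    with denominators cleared throughout. *)
Lemma weighted_sqr_le (R : realFieldType) (x c b m n A B r1 r2 r : R) :
    0 <= x -> 0 < c -> 0 < b -> 0 <= m -> 0 <= n -> 0 <= A -> 0 <= B ->
    0 <= r1 -> 0 <= r2 -> 0 <= r -> r1 ^+ 2 <= A * m -> r2 ^+ 2 <= B * n ->
    r <= r1 + r2 -> x * (m * c + n * b) <= b * c ->
  x * r ^+ 2 <= c * B + b * A.
Proof.
move=> x0 c0 b0 m0 n0 A0 B0 r10 r20 r0 h1 h2 hr hx.
have cb0 : 0 < b * c by rewrite mulr_gt0.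
have c0' := ltW c0; have b0' := ltW b0.
(* The cross term is bounded by the arithmetic-geometric mean inequality, compared after squaring to
   avoid roots. *)
have hAB : 2 * (b * c) * (r1 * r2) <= m * B * c ^+ 2 + n * A * b ^+ 2.
  have mB : 0 <= m * B * c ^+ 2 by rewrite !mulr_ge0 // ltW.
  have nA : 0 <= n * A * b ^+ 2 by rewrite !mulr_ge0 // ltW.
  rewrite -ler_sqr ?nnegrE ?addr_ge0 ?mulr_ge0 ?(ltW cb0) //.
  have h12 : (r1 * r2) ^+ 2 <= (m * B) * (n * A).
    by rewrite exprMn (le_trans (ler_pM _ _ h1 h2)) ?sqr_ge0 //; lra.
  have : 4 * (b * c) ^+ 2 * (r1 * r2) ^+ 2 <= 4 * (b * c) ^+ 2 * ((m * B) * (n * A)).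
    by rewrite ler_wpM2l // mulr_ge0 ?sqr_ge0.
  have := sqr_ge0 (m * B * c ^+ 2 - n * A * b ^+ 2).
  by move=> h3 h4; nra.
have hr2 : r ^+ 2 <= (r1 + r2) ^+ 2 by rewrite ler_sqr ?nnegrE ?addr_ge0.
have key : b * c * (r1 + r2) ^+ 2 <= (m * c + n * b) * (c * B + b * A).
  have h3 : b * c * r1 ^+ 2 <= b * c * (A * m) by apply: ler_wpM2l h1; apply: ltW.
  have h4 : b * c * r2 ^+ 2 <= b * c * (B * n) by apply: ler_wpM2l h2; apply: ltW.
  have -> : (m * c + n * b) * (c * B + b * A) = b * c * (A * m)
    + b * c * (B * n) + (m * B * c ^+ 2 + n * A * b ^+ 2) by ring.
  have -> : b * c * (r1 + r2) ^+ 2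
    = b * c * r1 ^+ 2 + b * c * r2 ^+ 2 + 2 * (b * c) * (r1 * r2) by ring.
  by rewrite !lerD.
rewrite -(ler_pM2l cb0).
have hcB : 0 <= c * B + b * A by rewrite addr_ge0 // mulr_ge0 // ltW.
apply: le_trans (_ : x * ((m * c + n * b) * (c * B + b * A)) <= _).
  rewrite mulrCA ler_wpM2l //; apply: le_trans key.
  by rewrite ler_wpM2l // ltW.
by rewrite mulrA ler_wpM2r.
Qed.

(** Only [s < 0] is delicate. There [weighted_sqr_le] asks for a condition affine in [m], since
    [m c + (k - m)(c - e) = k (c - e) + m e], and so it is enough to have it at [lo] and [hi]. *)
Lemma form_bound (R : realFieldType) (c e s k m lo hi S A B r1 r2 r : R) :
    0 <= c + e -> 0 <= c - e -> (c = 0 -> e = 0 -> 0 <= s) ->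
    0 <= m -> m <= k -> lo <= m -> m <= hi -> 0 < hi ->
    0 <= (c - e) * c + s * (k * (c - e) + lo * e) ->
    0 <= (c - e) * c + s * (k * (c - e) + hi * e) ->
    0 <= S -> 0 <= A -> 0 <= B -> 0 <= r1 -> 0 <= r2 -> 0 <= r ->
    r1 ^+ 2 <= A * m -> r2 ^+ 2 <= B * (k - m) -> r <= r1 + r2 ->
  0 <= (c + e) * S + (c - e) * A + c * B + s * r ^+ 2.
Proof.
move=> a0 b0 hs0 m0 mk lom mhi hi0 glo ghi S0 A0 B0 r10 r20 r0 h1 h2 hr.
have c0 : 0 <= c by lra.
have aS := mulr_ge0 a0 S0; have bA := mulr_ge0 b0 A0; have cB := mulr_ge0 c0 B0.
have [s0|s0] := leP 0 s.
  by rewrite !addr_ge0 // mulr_ge0 ?sqr_ge0.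
(* If [c = e], the condition at [hi] reads [s * hi * c >= 0]. With [s < 0] this forces [c = e = 0],
   which is the excluded degenerate case. *)
have bgt0 : 0 < c - e.
  rewrite lt_def b0 andbT; apply: contraTneq (s0) => be; rewrite -leNgt.
  have ec : e = c by lra.
  have c_le0 : s * (hi * c) >= 0 by move: ghi; rewrite be ec; lra.
  have cz : c = 0.
    apply/eqP; rewrite eq_le c0 andbT leNgt; apply/negP => cgt0.
    by move: c_le0; rewrite leNgt nmulr_rlt0 // mulr_gt0.
  by apply: hs0 => //; lra.
have cgt0 : 0 < c by lra.
have := @weighted_sqr_le _ (- s) c (c - e) m (k - m) A B r1 r2 r.
rewrite subr_ge0 oppr_ge0 => /(_ (ltW s0) cgt0 bgt0 m0 mk A0 B0 r10 r20 r0 h1 h2 hr) h.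
suff : - s * (m * c + (k - m) * (c - e)) <= (c - e) * c by move/h; lra.
have hs' : 0 <= - s by lra.
(* The sign of [e] decides which endpoint is the worst one. *)
have [e0|e0] := leP 0 e.
  have : - s * (m * e) <= - s * (hi * e) by rewrite ler_wpM2l ?ler_wpM2r.
  by lra.
have e0' : 0 <= - e by lra.
have := ler_wpM2l hs' (ler_wpM2r e0' lom); lra.
Qed.

Lemma sum_ord_eq k t : (\sum_(i < k) (i == t :> nat) = (t < k))%N.
Proof. by elim: k => [|k IH]; rewrite ?big_ord0 // big_ord_recr /= IH; lia. Qed.

(** For [h = d/2] this counts the pairs of [Omega] inside the first [k] coordinates. *)
Lemma sum_shift k h : (\sum_(i < k) \sum_(j < k) (j == i + h :> nat) = k - h)%N.
Proof.
under eq_bigr do rewrite sum_ord_eq.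
have -> : (\sum_(i < k) (i + h < k) = \sum_(i < k) (i < k - h))%N.
  by apply: eq_bigr => i _; congr nat_of_bool; lia.
have H n m : (\sum_(i < m) (i < n) = minn m n)%N.
  by elim: m => [|m IH]; rewrite ?big_ord0 ?min0n // big_ord_recr /= IH; lia.
by rewrite H; lia.
Qed.

(** Each odd [j] has exactly one partner, [j - 1], so the odd indices below [k] are counted. *)
Lemma sum_pairs k :
  (\sum_(i < k) \sum_(j < k) (~~ odd i && (j == i.+1 :> nat)) = k./2)%N.
Proof.
rewrite exchange_big /=.
have -> : (\sum_(j < k) \sum_(i < k) (~~ odd i && (j == i.+1 :> nat))
    = \sum_(j < k) odd j)%N.
  apply: eq_bigr => j _; case: (boolP (odd j)) => oj; last first.
    apply: big1 => i _; case: eqP => [ji|_]; last by rewrite andbF.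
    by move: oj; rewrite ji /= negbK => ->.
  have E i : ~~ odd i && (j == i.+1 :> nat) = (i == j.-1).
    by case: (val j) oj => // n /= n_odd; rewrite eqSS eq_sym; case: eqP => [->|]; rewrite ?n_odd ?andbF.
  under eq_bigr do rewrite E.
  by rewrite sum_ord_eq (leq_ltn_trans (leq_pred j) (ltn_ord j)).
by elim: k => [|k IH]; rewrite ?big_ord0 // big_ord_recr IH /= uphalf_half addnC.
Qed.

(** * k-positivity in terms of the extreme values *)

Section Criterion.
Local Open Scope sesquilinear_scope.
Variable R : realType.
Local Notation C := R[i].
Local Notation toC := (real_complex R).

Lemma Omega_trmxC d : (Omega R d)^t* = - Omega R d.
Proof. by rewrite -map_trmx Omega_conj Omega_trmx. Qed.

Section Gram.
Variables (k d : nat) (N : 'M[C]_(k, d)).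
Let U := map_mx Num.conj N *m Omega R d.

Lemma twist_unitary : ~~ odd d -> N \is unitarymx -> U \is unitarymx.
Proof.
move=> d_even Nu; apply: mul_unitarymx; last exact: Omega_unitary.
by rewrite conjC_unitary.
Qed.

(** The conjugation in [U] cancels that of the adjoint, so [G] is bilinear in [N] and inherits
    antisymmetry from [Omega]. *)
Lemma gramE : N *m U^t* = - (N *m Omega R d *m N^T).
Proof.
by rewrite trmxC_mul map_trmx map_mxCK Omega_trmxC mulNmx mulmxN mulmxA.
Qed.

Lemma gram_skew : (N *m U^t*)^T = - (N *m U^t*).
Proof.
rewrite gramE linearN /= !trmx_mul trmxK Omega_trmx mulNmx mulmxN mulmxA.
by [].
Qed.

End Gram.

(** The entries of [G] are 0, 1 or -1. The two indicators in an entry exclude each other as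
    [d/2 > 0], and each selected pair of [Omega] contributes at two transposed positions. *)
Lemma hs_gram_coordmx k d (f : 'I_k -> 'I_d) : (0 < d./2)%N ->
    let N : 'M[C]_(k, d) := coordmx C f in
    let G := N *m (map_mx Num.conj N *m Omega R d)^t* in
  hs G G = (2 * \sum_i \sum_j (f j == (f i + d./2)%N :> nat))%N%:R.
Proof.
move=> h_gt0 N G.
have GE i j : G i j * (G i j)^* = (f j == (f i + d./2)%N :> nat)%:R
    + (f i == (f j + d./2)%N :> nat)%:R.
  rewrite /G gramE mxE coordmx_form mxE rmorphN rmorphB /= !conjC_nat.
  have [->|_] := eqVneq (val (f j)) (f i + d./2)%N.
    have -> : (val (f i) == (f i + d./2 + d./2)%N) = false.
      by apply/negbTE; rewrite -addnA -{1}[val (f i)]addn0 eqn_add2l; case: (d./2) h_gt0.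
    by rewrite /=; ring.
  by case: (_ == _) => /=; ring.
rewrite hsE (eq_bigr _ (fun i _ => eq_bigr _ (fun j _ => GE i j))).
under eq_bigr do rewrite big_split /=.
rewrite big_split /= [X in _ + X]exchange_big /= mul2n -addnn natrD.
by rewrite natr_sum; congr (_ + _); apply: eq_bigr => i _; rewrite natr_sum.
Qed.

Lemma ge0_toC (z : C) : 0 <= z -> exists2 r, 0 <= r & z = toC r.
Proof.
move=> z0; exists (complex.Re z); first by rewrite -ler0c RRe_real ?ger0_real.
by rewrite RRe_real ?ger0_real.
Qed.

Lemma toC_real (x : R) : toC x \is Num.real.
Proof. by apply/CrealP; rewrite toC_conj. Qed.

Lemma quad_attained k d (N U : 'M[C]_(k, d)) (c s e : R) n :
    N \is unitarymx -> U \is unitarymx -> (N *m U^t*)^T = - (N *m U^t*) ->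
    hs (N *m U^t*) (N *m U^t*) = n%:R -> (n <= k)%N ->
    0 <= c + e -> 0 <= c - e ->
    (forall M, 0 <= quad (toC c) (toC s) (toC e) N U M) ->
  0 <= (c - e) * c + s * (k%:R * (c - e) + n%:R * e).
Proof.
move=> Nu Uu Gskew Gn nk a0 b0 H.
have := H (toC c *: (N *m U^t*) *m U
           + (toC c - toC e) *: (N - N *m U^t* *m U)).
rewrite (quad_extremal _ Nu Uu (toC_real c) (toC_real e) Gskew) Gn.
pose t := c * n%:R + (c - e) * (k%:R - n%:R).
have -> : toC c * n%:R + (toC c - toC e) * (k%:R - n%:R) = toC t.
  by rewrite /t rmorphD !rmorphM !rmorphB !rmorph_nat.
rewrite -rmorphB -!rmorphM -rmorphD -rmorphM ler0c => h.
have c0 : 0 <= c by lra.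
have t0 : 0 <= t.
  by apply: addr_ge0; apply: mulr_ge0; rewrite // subr_ge0 ler_nat.
have -> : (c - e) * c + s * (k%:R * (c - e) + n%:R * e) = c * (c - e) + s * t.
  by rewrite /t; ring.
(* The value at the extremal matrix is [t] times the desired quantity; for [t = 0] the latter is
   just [c * (c - e)]. *)
have [t_gt0|] := ltP 0 t; first by rewrite -(pmulr_rge0 _ t_gt0).
move=> t_le0; have -> : t = 0 by apply/eqP; rewrite eq_le t0 t_le0.
by rewrite mulr0 addr0 mulr_ge0.
Qed.

Lemma quad_ge0 k d (N U M : 'M[C]_(k, d)) (c s e lo hi : R) :
    N \is unitarymx -> U \is unitarymx -> (N *m U^t*)^T = - (N *m U^t*) ->
    toC lo <= hs (N *m U^t*) (N *m U^t*) ->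
    hs (N *m U^t*) (N *m U^t*) <= toC hi -> 0 < hi ->
    0 <= c + e -> 0 <= c - e -> (c = 0 -> e = 0 -> 0 <= s) ->
    0 <= (c - e) * c + s * (k%:R * (c - e) + lo * e) ->
    0 <= (c - e) * c + s * (k%:R * (c - e) + hi * e) ->
  0 <= quad (toC c) (toC s) (toC e) N U M.
Proof.
move=> Nu Uu Gskew lom mhi hi0 a0 b0 hs0 glo ghi.
have mk : hs (N *m U^t*) (N *m U^t*) <= k%:R.
  by rewrite -(unitarymx_hs Nu); apply: hs_unitary_mulr.
have [S [A [B [t1 [t2 [S0 A0 B0 [h1 h2 ->]]]]]]] :=
  quad_sym (toC c) (toC s) (toC e) M Nu Uu Gskew.
have [m m0 mE] := ge0_toC (hs_ge0 (N *m U^t*)).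
rewrite mE in h1 h2 lom mhi mk.
have [r1 r10 r1E] := ge0_toC (normr_ge0 t1).
have [r2 r20 r2E] := ge0_toC (normr_ge0 t2).
have [r r0 rE] := ge0_toC (normr_ge0 (t1 + t2)).
have hr := ler_normD t1 t2; rewrite rE r1E r2E -rmorphD lecR in hr.
have [S' S'0 SE] := ge0_toC S0; have [A' A'0 AE] := ge0_toC A0.
have [B' B'0 BE] := ge0_toC B0.
rewrite r1E AE -rmorphXn -rmorphM lecR in h1.
rewrite r2E BE -(rmorph_nat toC) -rmorphXn -rmorphB -rmorphM lecR in h2.
rewrite !lecR in lom mhi; rewrite -(rmorph_nat toC) lecR in mk.
rewrite rE SE AE BE -rmorphXn -rmorphD -rmorphB -!rmorphM -!rmorphD ler0c.
exact: (form_bound a0 b0 hs0 m0 mk lom mhi hi0 glo ghi S'0 A'0 B'0 r10 r20 r0).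
Qed.

(** The shape needed by [quad_attained] and [quad_ge0], with [c = 1 - p - q], [s = d p] and
    [e = d q]. *)
Lemma fpolyE d k (u p q : R) : fpoly d k u p q =
  (1 - p - q - d%:R * q) * (1 - p - q)
  + d%:R * p * (k%:R * (1 - p - q - d%:R * q) + u * (d%:R * q)).
Proof. by rewrite /fpoly; ring. Qed.

(* Sends [2j] and [2j+1] to the two indices [j] and [j + d/2] paired by [Omega]. *)
Definition pair_index k d (i : 'I_k) : nat := (i./2 + odd i * d./2)%N.

Lemma pair_index_lt k d (i : 'I_k) : ~~ odd d -> (k < d)%N ->
  (pair_index d i < d)%N.
Proof. by rewrite /pair_index; move: (ltn_ord i); case: (odd i); lia. Qed.

Lemma pair_index_eq k d (i j : 'I_k) : ~~ odd d -> (k < d)%N ->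
  (pair_index d j == pair_index d i + d./2)%N = ~~ odd i && (j == i.+1 :> nat).
Proof.
rewrite /pair_index; move: (ltn_ord i) (ltn_ord j) => /= ? ? ? ?.
by case: (boolP (odd i)); case: (boolP (odd j)) => /= *; apply/eqP/eqP; lia.
Qed.

Lemma k_positive_iff d k (p q : R) : (3 < d)%N -> ~~ odd d -> (1 < k < d)%N ->
  k_positive k (@calL R d p q) <->
  [/\ 0 <= 1 - p - q + d%:R * q, 0 <= 1 - p - q - d%:R * q,
      0 <= fpoly d k (2 * (k - d./2))%N%:R p q
    & 0 <= fpoly d k (k./2.*2)%:R p q].
Proof.
move=> d_gt3 d_even /andP[k_gt1 k_lt]; have k_le := ltnW k_lt.
have d_gt0 : (0 < d)%N by lia.
have h_gt0 : (0 < d./2)%N by lia.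
rewrite !fpolyE (k_positive_quad p q d_even d_gt0 k_le); split=> [H|[a0 b0 glo ghi]].
  have quadN (f : 'I_k -> 'I_d) : injective f ->
      let N := coordmx C f in let U := map_mx Num.conj N *m Omega R d in
      [/\ N \is unitarymx, U \is unitarymx,
          (N *m U^t*)^T = - (N *m U^t*) &
          forall M, 0 <= quad (toC (1 - p - q)) (toC (d%:R * p)) (toC (d%:R * q))
            N U M].
    move=> /(coordmx_unitary C) Nu; split.
    - exact: Nu.
    - exact: twist_unitary.
    - exact: gram_skew.
    - by move=> M; apply: H.
  (* The first [k] coordinate vectors contain as few pairs of [Omega] as
     possible, those selected by [pair_index] as many as possible. *)
  pose f1 (i : 'I_k) := widen_ord k_le i.
  have f1_inj : injective f1 by move=> i j /(congr1 val) /= /val_inj.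
  pose f2 (i : 'I_k) := Ordinal (pair_index_lt i d_even k_lt).
  have f2_inj : injective f2.
    move=> i j /(congr1 val) /=; rewrite /pair_index => ij; apply: val_inj => /=.
    move: (ltn_ord i) (ltn_ord j) ij.
    by case: (boolP (odd i)); case: (boolP (odd j)) => /=; lia.
  have [N1u U1u G1 H1] := quadN _ f1_inj; have [N2u U2u G2 H2] := quadN _ f2_inj.
  pose i0 := Ordinal (ltnW k_gt1); pose i1 := Ordinal k_gt1.
  have a0 : 0 <= 1 - p - q + d%:R * q.
    by rewrite -ler0c rmorphD; apply: (quad_coef_sym i0 U1u G1 H1).
  have b0 : 0 <= 1 - p - q - d%:R * q.
    (* Since [d >= 4], the coordinates 0 and 1 are not paired by [Omega], so the corresponding
       entries of [G] vanish. *)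
    rewrite -ler0c rmorphB; apply: (@quad_coef_skew _ _ _ _ _ _ _ _ i0 i1 U1u _ _ _ H1) => //.
      by rewrite gramE mxE coordmx_form mxE /= (_ : (_ == _) = false) ?subr0 ?oppr0 //; lia.
    by rewrite gramE mxE coordmx_form mxE /= (_ : (_ == _) = false) ?subr0 ?oppr0 //; lia.
  split=> //.
    apply: (quad_attained N1u U1u G1 _ _ a0 b0 H1); last by lia.
    by rewrite hs_gram_coordmx // sum_shift.
  apply: (quad_attained N2u U2u G2 _ _ a0 b0 H2); last by lia.
  rewrite hs_gram_coordmx //; congr (_%:R); rewrite -mul2n -(sum_pairs k).
  by congr (2 * _)%N; apply: eq_bigr => i _; apply: eq_bigr => j _; rewrite pair_index_eq.
move=> N M Nu; have Uu := twist_unitary d_even Nu; have Gskew := gram_skew N.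
have [lom mhi] := hs_gram_bounds d_even Nu Uu Gskew.
apply: quad_ge0 Nu Uu Gskew _ _ _ a0 b0 _ glo ghi => //.
- by rewrite rmorph_nat.
- by rewrite rmorph_nat.
- by rewrite ltr0n; lia.
(* The degenerate case is the point [p = 1], [q = 0], where [s = d]. *)
- move=> c0 /eqP; rewrite mulf_eq0 pnatr_eq0 => /orP[|/eqP q0]; first by lia.
  have -> : p = 1 by lra.
  by rewrite mulr1 ler0n.
Qed.

End Criterion.

(** * From the extreme values to the stated inequalities *)

Section Regions.
Variables (R : realType) (d k : nat) (p q : R).
Hypothesis d_gt0 : (0 < d)%N.
Hypothesis (alpha_ge0 : 0 <= 1 - p - q + d%:R * q).
Hypothesis (beta_ge0 : 0 <= 1 - p - q - d%:R * q).

Let dR : 0 < d%:R :> R. Proof. by rewrite ltr0n. Qed.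
Let gamma_ge0 : 0 <= 1 - p - q. Proof. by move: alpha_ge0 beta_ge0; lra. Qed.

(** The two hypotheses place [d q] between [-gamma] and [gamma], where [gamma = 1 - p - q]. *)
Lemma gamma0 : 1 - p - q = 0 -> p = 1 /\ q = 0.
Proof.
move=> g0; have qd : d%:R * q = 0 by move: alpha_ge0 beta_ge0; rewrite g0; lra.
by move/eqP: qd; rewrite mulf_eq0 gt_eqF //= => /eqP q0; split=> //; lra.
Qed.

(** At [u = k] the polynomial factors through [1 - p - q >= 0]. Where that factor vanishes, [p = 1]
    and [q = 0], and the linear inequality is immediate. *)
Lemma fpoly_top :
  0 <= fpoly d k k%:R p q <-> (1 - k%:R * d%:R) * p + (1 + d%:R) * q <= 1.
Proof.
have -> : fpoly d k k%:R p q =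
    (1 - p - q) * (1 - ((1 - k%:R * d%:R) * p + (1 + d%:R) * q)).
  by rewrite /fpoly; ring.
rewrite -[_ <= 1]subr_ge0; split=> h; last by rewrite mulr_ge0.
have [/gamma0[-> ->]|g_neq0] := eqVneq (1 - p - q) 0.
  have -> : 1 - ((1 - k%:R * d%:R) * 1 + (1 + d%:R) * 0) = k%:R * d%:R :> R by ring.
  by rewrite mulr_ge0.
by rewrite -(pmulr_rge0 _ (_ : 0 < 1 - p - q)) // lt_def g_neq0.
Qed.

(** At [u = 0] the polynomial has the factor [beta = 1 - p - q - d q]. On the line [beta = 0] it
    carries no information, but there [f_u] equals [u d (1 - p - q) p], so its sign at some [u > 0]
    yields [p >= 0] and with it the linear inequality. *)
Lemma fpoly_bot u : 0 < u -> 0 <= fpoly d k u p q ->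
  0 <= fpoly d k 0 p q <-> (1 - k%:R * d%:R) * p + q <= 1.
Proof.
move=> u_gt0 hu.
have -> : fpoly d k 0 p q =
    (1 - p - q - d%:R * q) * (1 - ((1 - k%:R * d%:R) * p + q)).
  by rewrite /fpoly; ring.
rewrite -[_ <= 1]subr_ge0; split=> h; last by rewrite mulr_ge0.
have [b0|b_neq0] := eqVneq (1 - p - q - d%:R * q) 0; last first.
  by rewrite -(pmulr_rge0 _ (_ : 0 < 1 - p - q - d%:R * q)) // lt_def b_neq0.
have -> : 1 - ((1 - k%:R * d%:R) * p + q) = 1 - p - q + k%:R * d%:R * p by ring.
suff p_ge0 : 0 <= p by rewrite addr_ge0 // !mulr_ge0.
have [/gamma0[-> _]//|g_neq0] := eqVneq (1 - p - q) 0.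
have g_gt0 : 0 < 1 - p - q by rewrite lt_def g_neq0.
have E : fpoly d k u p q = (u * d%:R * (1 - p - q)) * p.
  have -> : fpoly d k u p q = (1 - p - q - d%:R * q) *
      (1 - ((1 - k%:R * d%:R) * p + q)) + d%:R * u * p * (d%:R * q).
    by rewrite /fpoly; ring.
  have -> : d%:R * q = 1 - p - q by lra.
  by rewrite subrr mul0r add0r; ring.
by rewrite -(pmulr_rge0 _ (_ : 0 < u * d%:R * (1 - p - q))) -?E // !mulr_gt0.
Qed.

End Regions.

Theorem theorem3p4 (R : realType) (d k : nat) (hd : (4 <= d)%N)
    (d_even : ~~ odd d) (hk : (1 < k < d)%N) (p q : R) :
  [/\ ((1 < k <= d./2)%N -> ~~ odd k ->
        (k_positive k (@calL R d p q) <->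
         [/\ p + (1 + d%:R) * q <= 1,
             (1 - k%:R * d%:R) * p + (1 + d%:R) * q <= 1,
             (1 - k%:R * d%:R) * p + q <= 1
           & p + (1 - d%:R) * q <= 1])),
      ((1 < k <= d./2)%N -> odd k ->
        (k_positive k (@calL R d p q) <->
         [/\ p + (1 + d%:R) * q <= 1,
             0 <= fpoly d k (k%:R - 1) p q,
             (1 - k%:R * d%:R) * p + q <= 1
           & p + (1 - d%:R) * q <= 1])),
      ((d./2 < k < d)%N -> ~~ odd k ->
        (k_positive k (@calL R d p q) <->
         [/\ p + (1 + d%:R) * q <= 1,
             (1 - k%:R * d%:R) * p + (1 + d%:R) * q <= 1,
             0 <= fpoly d k (2 * k%:R - d%:R) p q
           & p + (1 - d%:R) * q <= 1]))
    & ((d./2 < k < d)%N -> odd k ->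
        (k_positive k (@calL R d p q) <->
         [/\ p + (1 + d%:R) * q <= 1,
             0 <= fpoly d k (k%:R - 1) p q,
             0 <= fpoly d k (2 * k%:R - d%:R) p q
           & p + (1 - d%:R) * q <= 1]))].
Proof.
have [k_gt1 k_lt] := andP hk.
have d_gt0 : (0 < d)%N by lia.
have alphaE : (p + (1 - d%:R) * q <= 1) = (0 <= 1 - p - q + d%:R * q).
  by rewrite -subr_ge0; congr (0 <= _); ring.
have betaE : (p + (1 + d%:R) * q <= 1) = (0 <= 1 - p - q - d%:R * q).
  by rewrite -subr_ge0; congr (0 <= _); ring.
have topE : odd k -> (k./2.*2)%:R = k%:R - 1 :> R.
  move=> k_odd; rewrite -[1]/(1%:R) -natrB; last by lia.
  by have -> : (k - 1 = k./2.*2)%N by lia.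
have botE : (d./2 < k)%N -> (2 * (k - d./2))%N%:R = 2 * k%:R - d%:R :> R.
  move=> hk2; rewrite -natrM -natrB; last by lia.
  by have -> : (2 * k - d = 2 * (k - d./2))%N by lia.
have bot0 : (k <= d./2)%N -> (2 * (k - d./2))%N%:R = 0 :> R.
  by move=> hk2; have -> : (2 * (k - d./2) = 0)%N by lia.
have hi_gt0 : 0 < (k./2.*2)%:R :> R by rewrite ltr0n; lia.
rewrite alphaE betaE; split=> /andP[h1 h2] kodd;
  rewrite (k_positive_iff p q hd d_even hk).
- have kR : 0 < k%:R :> R by rewrite ltr0n; lia.
  rewrite (bot0 h2) even_halfK //; split=> [[a b l h]|[b h l a]].
    split=> //; first exact/(fpoly_top _ d_gt0 a b).
    exact/(fpoly_bot d_gt0 a b kR h).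
  (* The equivalence at [u = 0] relies on the inequality at [u = k], so that one is recovered
     first. *)
  have h' : 0 <= fpoly d k k%:R p q by apply/(fpoly_top _ d_gt0 a b).
  by split=> //; apply/(fpoly_bot d_gt0 a b kR h').
- rewrite (bot0 h2) topE // in hi_gt0 *; split=> [[a b l h]|[b h l a]].
    by split=> //; apply/(fpoly_bot d_gt0 a b hi_gt0 h).
  by split=> //; apply/(fpoly_bot d_gt0 a b hi_gt0 h).
- rewrite (botE h1) even_halfK //; split=> [[a b l h]|[b h l a]].
    by split=> //; apply/(fpoly_top _ d_gt0 a b).
  by split=> //; apply/(fpoly_top _ d_gt0 a b).
- by rewrite (botE h1) topE //; split=> [[a b l h]|[b h l a]].
Qed.
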